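(* Let $h(n)=\mathbb{E}[G_n]/\sqrt{n}$ for $n\in\mathbb{N}$, $n\ge1$. Then, as $n\to\infty$, $$h(n)=\sqrt{\frac{\pi}{2}}-\frac{1}{3\sqrt{n}}+o\!\left(\frac{1}{\sqrt n}\right),$$ and consequently $\lim_{n\to\infty}h(n)=\sqrt{\pi/2}$.
   Context: Let $X_1,X_2,\ldots$ be independent random variables, each uniformly distributed on $\{1,2,\ldots,n\}$. The gain is $G_n=\min\{k\in\{1,\ldots,n\}: X_k\le k\}$ (well defined since $X_n\le n$). Its probability mass function is $p_{k,n}=\mathbb{P}(G_n=k)=\frac{k}{n^k}\cdot\frac{(n-1)!}{(n-k)!}$ for $1\le k\le n$, so $\mathbb{E}[G_n]=\sum_{k=1}^n k\,p_{k,n}$. *)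

(* Defs.v *)
From HB Require Import structures.
From mathcomp Require Import all_boot all_order all_algebra.
From mathcomp Require Import finmap.
From mathcomp Require Import all_classical all_reals all_analysis.

Set Implicit Arguments.
Unset Strict Implicit.
Unset Printing Implicit Defensive.

Import Order.TTheory GRing.Theory Num.Theory.
Import numFieldNormedType.Exports.

Local Open Scope classical_set_scope.
Local Open Scope ring_scope.

Definition mutually_independent {d d' : measure_display}
    {T : measurableType d} {T' : measurableType d'} {R : realType}
    {P : probability T R} {I : choiceType} (K : set I)
    (X : I -> {RV P >-> T'}) : Prop :=
  forall J : {fset I}, [set` J] `<=` K ->
  forall B : I -> set T', (forall j, measurable (B j)) ->
  P (\bigcap_(j in [set` J]) (X j @^-1` B j)) =
    (\prod_(j <- J) P (X j @^-1` B j))%E.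

(* [Y] is uniform on {1, ..., n}: the masses sum to 1, so all other values
   of [Y] together have probability 0. *)
Definition uniform_on_1_to {d : measure_display} {T : measurableType d}
    {R : realType} {P : probability T R} (n : nat) (Y : {RV P >-> nat}) :
    Prop :=
  forall m : nat, (1 <= m <= n)%N ->
    distribution P Y [set m] = (n%:R^-1)%:E.

(* [x k] is the value of X_k; the entry [x 0] is not used.  The default value
   [n] of the minimum belongs to the set as soon as [x n <= n], which holds
   almost surely when X_n is uniform on {1, ..., n}; see [gainP]. *)
Definition gain (n : nat) (x : nat -> nat) : nat :=
  \big[minn/n]_(1 <= k < n.+1 | (x k <= k)%N) k.

Lemma gainP (n : nat) (x : nat -> nat) : (0 < n)%N -> (x n <= n)%N ->
  [/\ (1 <= gain n x <= n)%N, (x (gain n x) <= gain n x)%N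
    & forall k, (1 <= k <= n)%N -> (x k <= k)%N -> (gain n x <= k)%N].
Proof.
move=> n_gt0 xn.
have : (1 <= gain n x <= n)%N && (x (gain n x) <= gain n x)%N.
  rewrite /gain big_seq_cond.
  apply: (big_ind (fun g => (1 <= g <= n)%N && (x g <= g)%N)).
  - by rewrite n_gt0 leqnn xn.
  - by move=> a b Ha Hb; rewrite /minn; case: ifP.
  - by move=> k; rewrite mem_index_iota ltnS => /andP[-> ->].
case/andP => h1 h2; split => // k kn xk; rewrite /gain.
have : k \in index_iota 1 n.+1 by rewrite mem_index_iota ltnS.
elim: (index_iota 1 n.+1) => // a s IH; rewrite inE big_cons.
case/predU1P => [<-|/IH H]; first by rewrite xk geq_minl.
by case: ifP => // _; rewrite (leq_trans (geq_minr _ _)).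
Qed.

(* The expectation is finite since the gain is bounded by [n], so [fine] does
   not lose anything. *)
Definition expected_gain {d : measure_display} {T : measurableType d}
    {R : realType} {P : probability T R} (n : nat)
    (X : nat -> {RV P >-> nat}) : R :=
  fine ('E_P[fun w : T => (gain n (fun k => X k w))%:R])%E.

(* Main.v *)
Require Import Defs.
From HB Require Import structures.
From mathcomp Require Import all_boot all_order all_algebra.
From mathcomp Require Import all_classical all_reals all_analysis.
From mathcomp Require Import finmap measurable_realfun.
From mathcomp Require Import ring lra zify.

Set Implicit Arguments.
Unset Strict Implicit.
Unset Printing Implicit Defensive.

Import Order.TTheory GRing.Theory Num.Theory.
Import numFieldNormedType.Exports.

Local Open Scope classical_set_scope.
Local Open Scope ring_scope.

(** Since [gain > k] means [X_j > j] for all [1 <= j <= k], independence gives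
  [E G_n = Q(n) := sum_(k < n) prod_(1 <= j <= k) (1 - j / n)], Ramanujan's
  Q-function.  With [s = sqrt n], expanding and integrating termwise,
  [Q(n) / s = int_0^oo f] where [f y = exp (- s y) (1 + y / s) ^ (n - 1)].
  The bounds on [ln (1 + u)] up to order four give, with
  [g y = exp (- y^2 / 2)],
  [| f - g - (y^3 / 3 - y) g / s | <= (y^2 + y^4 + y^6) exp ((1 - y) / 2) / s^2].
  Integrating, [Q(n) / s = sqrt (pi / 2) + (2 / 3 - 1) / s + O (1 / n)]. *)

(** * Bounds on [ln (1 + u)] by comparing derivatives *)

Lemma is_derive_le (R : realType) (f g df dg : R -> R) :
  (forall x : R, 0 <= x -> is_derive x 1 f (df x)) ->
  (forall x : R, 0 <= x -> is_derive x 1 g (dg x)) ->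
  f 0 = g 0 -> (forall x : R, 0 <= x -> df x <= dg x) ->
  forall x : R, 0 <= x -> f x <= g x.
Proof.
move=> f' g' fg0 dfg x x0; rewrite -subr_ge0.
have d (y : R) : 0 <= y -> is_derive y 1 (g - f) (dg y - df y).
  by move=> y0; apply: is_deriveB; [exact: g'|exact: f'].
have [||c cx] := @MVT_segment R (g - f) (fun y => dg y - df y) 0 x x0.
- by move=> y; rewrite in_itv/= => /andP[/ltW y0 _]; exact: d.
- apply: derivable_within_continuous => y.
  by rewrite in_itv/= => /andP[y0 _]; have [] := d _ y0.
rewrite !fctE fg0 subrr !subr0 => ->; move: cx; rewrite in_itv/= => /andP[c0 _].
by rewrite mulr_ge0// subr_ge0 dfg.
Qed.

Lemma is_derive_ln1D (R : realType) (u : R) : 0 <= u ->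
  is_derive u 1 (fun x : R => ln (1 + x)) (1 + u)^-1.
Proof.
move=> u0; have h : 0 < 1 + u by lra.
have h1 := is_derive1_ln h.
by apply: is_derive_eq; rewrite add0r mulr1.
Qed.

Section ln1D_bounds.
Context {R : realType} (u : R).
Hypothesis u0 : 0 <= u.

Lemma ln1D_ge2 : u - u ^+ 2 / 2 <= ln (1 + u).
Proof.
apply: (@is_derive_le R (fun u => u - u ^+ 2 / 2) (fun u => ln (1 + u))
  (fun u => 1 - u) (fun u => (1 + u)^-1)) u0 => [x x0|x x0||x x0].
- by apply: is_derive_eq; rewrite /GRing.scale/=; field.
- exact: is_derive_ln1D.
- by rewrite addr0 ln1; ring.
- have x1 : 0 < 1 + x by lra.
  by rewrite -[leRHS]div1r ler_pdivlMr//; nra.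
Qed.

Lemma ln1D_le3 : ln (1 + u) <= u - u ^+ 2 / 2 + u ^+ 3 / 3.
Proof.
apply: (@is_derive_le R (fun u => ln (1 + u))
  (fun u => u - u ^+ 2 / 2 + u ^+ 3 / 3)
  (fun u => (1 + u)^-1) (fun u => 1 - u + u ^+ 2)) u0 => [x x0|x x0||x x0].
- exact: is_derive_ln1D.
- by apply: is_derive_eq; rewrite /GRing.scale/=; field.
- by rewrite addr0 ln1; ring.
- have x1 : 0 < 1 + x by lra.
  rewrite -[leLHS]div1r ler_pdivrMr// -subr_ge0.
  by rewrite (_ : _ - _ = x ^+ 3) ?exprn_ge0//; ring.
Qed.

Lemma ln1D_ge4 :
  u - u ^+ 2 / 2 + u ^+ 3 / 3 - u ^+ 4 / 4 <= ln (1 + u).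
Proof.
apply: (@is_derive_le R (fun u => u - u ^+ 2 / 2 + u ^+ 3 / 3 - u ^+ 4 / 4)
  (fun u => ln (1 + u)) (fun u => 1 - u + u ^+ 2 - u ^+ 3)
  (fun u => (1 + u)^-1)) u0 => [x x0|x x0||x x0].
- by apply: is_derive_eq; rewrite /GRing.scale/=; field.
- exact: is_derive_ln1D.
- by rewrite addr0 ln1; ring.
- have x1 : 0 < 1 + x by lra.
  rewrite -[leRHS]div1r ler_pdivlMr// -subr_ge0.
  by rewrite (_ : _ - _ = x ^+ 4) ?exprn_ge0//; ring.
Qed.

(** The cubic upper bound is useless for large [u]. This one stays below [u] by an amount growing
    linearly, which is what gives exponential decay on the whole half-line. *)
Lemma ln1D_le_frac : ln (1 + u) <= u - u ^+ 2 / (2 * (1 + u)).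
Proof.
apply: (@is_derive_le R (fun u => ln (1 + u))
  (fun u => u - u ^+ 2 / (2 * (1 + u)))
  (fun u => (1 + u)^-1)
  (fun u => (1 + u)^-1 + u ^+ 2 / (2 * (1 + u) ^+ 2))) u0
  => [x x0|x x0||x x0].
- exact: is_derive_ln1D.
- have x1 : 2 * (1 + x) != 0 by rewrite gt_eqF//; lra.
  have x2 : 1 + x != 0 by rewrite gt_eqF//; lra.
  have d := @is_deriveV R (fun u : R => 2 * (1 + u)) x _ 1 x1 _.
  by apply: is_derive_eq; rewrite /GRing.scale/=; field.
- by rewrite addr0 ln1; field.
- by rewrite lerDl divr_ge0 ?exprn_ge0// mulr_ge0// exprn_ge0//; lra.
Qed.

End ln1D_bounds.

(** * Pointwise Gaussian approximation of the integrand *)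

Section integrand_estimate.
Context {R : realType} (n : nat) (s : R).
Hypotheses (n0 : (0 < n)%N) (s0 : 0 < s) (sn : s ^+ 2 = n%:R).

Let s_neq0 : s != 0. Proof. by rewrite gt_eqF. Qed.

Let s1 : 1 <= s.
Proof. by rewrite -(@expr_ge1 _ 2) ?(ltW s0)// sn ler1n. Qed.

Let E (y : R) := expR (- (s * y)) * (1 + y / s) ^+ n.

Let u_ge0 (y : R) : 0 <= y -> 0 <= y / s.
Proof. by move=> y0; rewrite divr_ge0// ltW. Qed.

Let E_ln (y : R) : 0 <= y ->
  E y = expR (n%:R * ln (1 + y / s) - s * y).
Proof.
move=> y0; have u0 := u_ge0 y0.
by rewrite addrC expRD expRM_natl lnK// posrE; lra.
Qed.

(** A domination free of [n]. By [ln1D_le_frac] the exponent of [E y] is at most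
    [- y^2 / (2 (1 + y / s))]. Since [s >= 1] gives [y / s <= y], and [(y - 1) (y + 1) <= y^2], this
    is at most [(1 - y) / 2]. *)
Lemma tilted_power_le (y : R) : 0 <= y -> E y <= expR ((1 - y) / 2).
Proof.
move=> y0; have u0 := u_ge0 y0; rewrite E_ln// ler_expR -sn.
have h : s ^+ 2 * ln (1 + y / s) - s * y <= - (y ^+ 2 / (2 * (1 + y / s))).
  have -> : - (y ^+ 2 / (2 * (1 + y / s))) =
      s ^+ 2 * (y / s - (y / s) ^+ 2 / (2 * (1 + y / s))) - s * y.
    by field; rewrite s_neq0/= gt_eqF// ltr_wpDr.
  by rewrite lerD2r ler_wpM2l ?exprn_ge0 ?(ltW s0)// ln1D_le_frac.
apply: (le_trans h).
have us : y / s <= y by rewrite ler_pdivrMr// ler_peMr.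
rewrite lerNl ler_pdivlMr; last lra.
rewrite [leLHS](_ : _ = (y - 1) * (1 + y / s)); last by field.
have [y1|y1] := leP y 1.
  by apply: (@le_trans _ _ 0); [rewrite mulr_le0_ge0//; lra|rewrite exprn_ge0].
have : (y - 1) * (1 + y / s) <= (y - 1) * (1 + y) by rewrite ler_wpM2l//; lra.
by move/le_trans; apply; rewrite -subr_ge0; lra.
Qed.

(** Writing [E y = g * expR delta] with [delta] close to [y^3 / (3 s)] produces the cubic
    correction. The exponent [n.-1] instead of [n] means a division by [1 + y / s], which produces
    the correction [- y g / s]. All that remains is of order [s^-2]. *)
Lemma gauss_estimate (y : R) : 0 <= y ->
  `|expR (- (s * y)) * (1 + y / s) ^+ n.-1 -
    (expR (- (y ^+ 2 / 2)) + (y ^+ 3 / 3 - y) * expR (- (y ^+ 2 / 2)) / s)|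
  <= (y ^+ 2 + y ^+ 4 + y ^+ 6) * expR ((1 - y) / 2) / s ^+ 2.
Proof.
move=> y0; have u0 := u_ge0 y0.
(* The error is first bounded with [E y] as weight, and [tilted_power_le] replaces that weight at
   the end. *)
apply: le_trans (_ : (y ^+ 2 + y ^+ 4 + y ^+ 6) * E y / s ^+ 2 <= _); last first.
  rewrite ler_wpM2r ?invr_ge0 ?exprn_ge0 ?(ltW s0)// ler_wpM2l//.
    by rewrite !addr_ge0 ?exprn_ge0.
  exact: tilted_power_le.
set g := expR (- (y ^+ 2 / 2)); set f := expR _ * _.
have fE : f * (1 + y / s) = E y by rewrite -mulrA -exprSr prednK.
set t := s^-1 in u0 fE *.
have t0 : 0 < t by rewrite invr_gt0.
have t1 : t <= 1 by rewrite invf_le1.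
pose delta := n%:R * ln (1 + y * t) - s * y + y ^+ 2 / 2.
have Eg : E y = g * expR delta.
  by rewrite E_ln// -expRD; congr expR; rewrite /delta /t; field.
have st : s * t = 1 by rewrite divff.
have d0 : 0 <= delta.
  rewrite (_ : 0 = s ^+ 2 * (y * t - (y * t) ^+ 2 / 2) - s * y + y ^+ 2 / 2).
    by rewrite /delta -sn !lerD2r ler_wpM2l ?exprn_ge0 ?(ltW s0)// ln1D_ge2.
  by rewrite /t; field.
have d_le : delta <= t * y ^+ 3 / 3.
  rewrite [leRHS](_ : _ = s ^+ 2 * (y * t - (y * t) ^+ 2 / 2 + (y * t) ^+ 3 / 3)
    - s * y + y ^+ 2 / 2).
    by rewrite /delta -sn !lerD2r ler_wpM2l ?exprn_ge0 ?(ltW s0)// ln1D_le3.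
  by rewrite /t; field.
have d_ge : t * y ^+ 3 / 3 - t ^+ 2 * y ^+ 4 / 4 <= delta.
  rewrite [leLHS](_ : _ = s ^+ 2 *
    (y * t - (y * t) ^+ 2 / 2 + (y * t) ^+ 3 / 3 - (y * t) ^+ 4 / 4)
    - s * y + y ^+ 2 / 2).
    by rewrite /delta -sn !lerD2r ler_wpM2l ?exprn_ge0 ?(ltW s0)// ln1D_ge4.
  by rewrite /t; field.
have g0 : 0 < g by exact: expR_gt0.
have E0 : 0 < E y by rewrite Eg mulr_gt0// expR_gt0.
(* The inequality [1 + x <= expR x], taken at [delta] and at [- delta], encloses [E y - g] between
   [g * delta] and [delta * E y]. *)
have gE : g * delta <= E y - g.
  have := expR_ge1Dx delta; rewrite Eg; nra.
have Eg_le : E y - g <= delta * E y.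
  have h := expR_ge1Dx (- delta).
  have : g = E y * expR (- delta) by rewrite Eg -mulrA -expRD subrr expR0 mulr1.
  nra.
move: (E y) fE Eg_le gE E0 => e fE Eg_le gE E0.
clear Eg E_ln; move: delta d0 d_le d_ge Eg_le gE => r r0 rle rge hle hge.
rewrite (_ : s ^- 2 = t ^+ 2); last by rewrite /t exprVn.
have y2 : 0 <= y ^+ 2 by rewrite exprn_ge0.
have y3 : 0 <= y ^+ 3 by rewrite exprn_ge0.
have y4 : 0 <= y ^+ 4 by rewrite exprn_ge0.
have y6 : 0 <= y ^+ 6 by rewrite exprn_ge0.
have ge : g <= e by nra.
have ele : e - g <= t * y ^+ 3 / 3 * e by nra.
(* The first-order bound [ele] is inserted into itself: [e = g + (e - g)] leaves [g] in the term of
   order [t] and pushes [e] into the term of order [t ^+ 2]. *)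
have ele2 : e - g <= t * y ^+ 3 / 3 * g + t ^+ 2 * y ^+ 6 / 9 * e.
  apply: (le_trans hle).
  apply: le_trans (_ : t * y ^+ 3 / 3 * e <= _); first by rewrite ler_wpM2r// ltW.
  have ty3 : 0 <= t * y ^+ 3 / 3 by rewrite !mulr_ge0// ltW.
  have := ler_wpM2l ty3 ele.
  rewrite mulrBr; set a := t * y ^+ 3 / 3.
  have -> : t ^+ 2 * y ^+ 6 / 9 = a * a by rewrite /a; field.
  by rewrite mulrA; lra.
have ege : (t * y ^+ 3 / 3 - t ^+ 2 * y ^+ 4 / 4) * g <= e - g.
  by apply: le_trans hge; rewrite mulrC ler_wpM2l// ltW.
have ty0 : 0 < 1 + y * t by lra.
have f0 : 0 < f by rewrite -(pmulr_lgt0 _ ty0) fE.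
(* With [v = y * t], so that [f = e / (1 + v)], this and [f_le] are the bounds
   [1 - v <= 1 / (1 + v) <= 1 - v + v^2]. *)
have f_ge : e - y * t * e <= f.
  rewrite -fE -subr_ge0 (_ : _ - _ = (y * t) ^+ 2 * f); last by ring.
  by rewrite mulr_ge0 ?exprn_ge0// ltW.
have f_le : f <= e - y * t * e + (y * t) ^+ 2 * e.
  rewrite -fE -subr_ge0 (_ : _ - _ = (y * t) ^+ 3 * f); last by ring.
  by rewrite mulr_ge0 ?exprn_ge0// ltW.
have tt0 : 0 <= t ^+ 2 by rewrite exprn_ge0// ltW.
pose a := t ^+ 2 * e; have a0 : 0 <= a by rewrite mulr_ge0// ltW.
have ga : t ^+ 2 * g <= a by rewrite ler_wpM2l.
have ay2 : 0 <= y ^+ 2 * a by rewrite mulr_ge0.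
have ay4 : 0 <= y ^+ 4 * a by rewrite mulr_ge0.
have ay6 : 0 <= y ^+ 6 * a by rewrite mulr_ge0.
have gy4 : y ^+ 4 * (t ^+ 2 * g) <= y ^+ 4 * a by rewrite ler_wpM2l.
have yte : y * t * (e - g) <= y ^+ 4 * a / 3.
  rewrite [leRHS](_ : _ = y * t * (t * y ^+ 3 / 3 * e)); last by rewrite /a; field.
  by rewrite ler_wpM2l.
have yte0 : y * t * g <= y * t * e by rewrite ler_wpM2l.
(* Each of the two gaps is displayed as a sum of quantities already known to be nonnegative. *)
rewrite ler_norml; apply/andP; split; rewrite -subr_ge0.
  have -> : f - (g + (y ^+ 3 / 3 - y) * g * t) -
      - ((y ^+ 2 + y ^+ 4 + y ^+ 6) * e * t ^+ 2) =
    (f - (e - y * t * e)) +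
    (e - g - (t * y ^+ 3 / 3 - t ^+ 2 * y ^+ 4 / 4) * g) +
    (y ^+ 4 * a / 3 - y * t * (e - g)) +
    (y ^+ 4 * a - y ^+ 4 * (t ^+ 2 * g)) / 4 +
    (y ^+ 2 * a + 5 / 12 * (y ^+ 4 * a) + y ^+ 6 * a) by rewrite /a; field.
  lra.
have -> : (y ^+ 2 + y ^+ 4 + y ^+ 6) * e * t ^+ 2 -
    (f - (g + (y ^+ 3 / 3 - y) * g * t)) =
  (e - y * t * e + (y * t) ^+ 2 * e - f) +
  (t * y ^+ 3 / 3 * g + t ^+ 2 * y ^+ 6 / 9 * e - (e - g)) +
  (y * t * e - y * t * g) +
  (y ^+ 4 * a + 8 / 9 * (y ^+ 6 * a)) by rewrite /a; field.
lra.
Qed.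

End integrand_estimate.

Lemma exprn_le_expR (R : realType) (x : R) n : 0 <= x ->
  x ^+ n.+1 <= n.+1`!%:R * expR x.
Proof.
move=> x0; rewrite mulrC -ler_pdivrMr ?ltr0n ?fact_gt0//.
by apply: le_trans (expR_ge1Dxn n x0); rewrite lerDr.
Qed.

(** Half of the decay [expR (- y / 2)] absorbs the powers, since [y^m expR (- y / 4) <= 4^m m!]. The
    other half remains as an integrable majorant. *)
Lemma poly_expR_bound (R : realType) : exists2 K : R, 0 <= K &
  forall y : R, 0 <= y ->
    (y ^+ 2 + y ^+ 4 + y ^+ 6) * expR ((1 - y) / 2) <= K * expR (- (y / 4)).
Proof.
exists ((4 ^+ 2 * 2`!%:R + 4 ^+ 4 * 4`!%:R + 4 ^+ 6 * 6`!%:R) * expR (1 / 2)).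
  by rewrite mulr_ge0 ?expR_ge0// !addr_ge0// mulr_ge0.
move=> y y0; have y40 : 0 <= y / 4 by rewrite divr_ge0.
have -> : expR ((1 - y) / 2) = expR (- (y / 4)) * expR (1 / 2) * expR (- (y / 4)).
  by rewrite -!expRD; congr expR; field.
rewrite !mulrA ler_wpM2r ?expR_ge0// ler_wpM2r ?expR_ge0//.
have h m : y ^+ m.+1 * expR (- (y / 4)) <= 4 ^+ m.+1 * m.+1`!%:R.
  rewrite expRN ler_pdivrMr ?expR_gt0// -mulrA.
  by rewrite -ler_pdivrMl ?exprn_gt0// -exprVn -exprMn mulrC exprn_le_expR.
by rewrite !mulrDl !lerD.
Qed.

(** * Improper integrals from antiderivatives *)

Section FTC.
Context {R : realType}.
Notation mu := (@lebesgue_measure R).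

(** As [f] is nonnegative on the half-line, the finite value [l - F a] is also the integral of its
    absolute value, so integrability comes with the value. *)
Lemma ge0_FTC2y (f F : R -> R) (a l : R) :
  (forall x, a <= x -> 0 <= f x) -> continuous f ->
  (forall x : R, is_derive x 1 F (f x)) -> F x @[x --> +oo] --> l ->
  mu.-integrable `[a, +oo[ (EFin \o f) /\
  \int[mu]_(x in `[a, +oo[) f x = l - F a.
Proof.
move=> f0 cf dF Fl.
have cF : continuous F.
  by move=> x; apply: differentiable_continuous; apply/derivable1_diffP; have [] := dF x.
have I : (\int[mu]_(x in `[a, +oo[) (f x)%:E = l%:E - (F a)%:E)%E.
  apply: ge0_continuous_FTC2y => //.
  - exact: continuous_subspaceT.
  - by apply: cvg_at_right_filter; exact: cF.
  - by move=> x _; rewrite derive1E; have [] := dF x.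
split; last by rewrite /Rintegral I.
apply/integrableP; split.
  apply/measurable_EFinP; apply: measurable_funTS.
  exact: continuous_measurable_fun.
have -> : (\int[mu]_(x in `[a, +oo[) `|(EFin \o f) x| =
    \int[mu]_(x in `[a, +oo[) (f x)%:E)%E; last by rewrite I ltry.
apply: eq_integral => x /set_mem/=; rewrite in_itv/= andbT.
by move=> ax; rewrite ger0_norm ?f0.
Qed.

Lemma expRN_scale_cvg0 (c : R) : 0 < c -> expR (- (c * x)) @[x --> +oo] --> (0 : R).
Proof.
move=> c0; apply: (@cvg_comp _ _ _ (fun x => c * x) (fun x => expR (- x))).
  by apply: gt0_cvgMry.
exact: cvgr_expR.
Qed.

Lemma integrable_expRN_scale (c : R) : 0 < c ->
  mu.-integrable `[0%R, +oo[ (EFin \o (fun x => expR (- (c * x)))).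
Proof.
move=> c0.
apply: (proj1 (@ge0_FTC2y (fun x => expR (- (c * x)))
  (fun x => - c^-1 * expR (- (c * x))) 0 0 _ _ _ _)).
- by move=> x _; exact: expR_ge0.
- move=> x; apply: continuous_comp; last exact: continuous_expR.
  by apply: continuousN; apply: continuousM => //; exact: cst_continuous.
- move=> x; apply: is_derive_eq; rewrite /GRing.scale/=; field.
  by rewrite gt_eqF.
- rewrite -(mulr0 (- c^-1)); apply: cvgM; first exact: cvg_cst.
  exact: expRN_scale_cvg0.
Qed.

End FTC.

(** * Half-line moments of the Gaussian *)

Section gauss_moments.
Context {R : realType}.
Notation mu := (@lebesgue_measure R).
Let g (x : R) := expR (- (x ^+ 2 / 2)).

Let cg : continuous g.
Proof.
move=> x; apply: continuous_comp; last exact: continuous_expR.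
apply: continuousN; apply: continuousM; last exact: cst_continuous.
exact: exprn_continuous.
Qed.

Let g_le (x : R) : g x <= expR ((1 - x) / 2).
Proof. rewrite ler_expR; have : 0 <= (x - 2^-1) ^+ 2 by rewrite sqr_ge0. nra. Qed.

(** The standard normal density is even with total mass 1, so it has mass 1/2 on the half-line.
    Dividing by its peak value [c] gives the integral of [g]. *)
Lemma half_gauss_integral :
  mu.-integrable `[0%R, +oo[ (EFin \o g) /\
  \int[mu]_(x in `[0, +oo[) g x = Num.sqrt (pi / 2).
Proof.
pose c : R := normal_peak 1.
have c0 : 0 < c by rewrite normal_peak_gt0.
have pdfE : normal_pdf 0 1 = (fun x => c * g x) :> (R -> R).
  apply/funext => x; rewrite normal_pdfE ?oner_eq0// /normal_fun /g subr0 expr1n.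
  by rewrite mulNr mulr2n.
have I : (\int[mu]_(x in `[0%R, +oo[) (c * g x)%:E = (2^-1)%:E)%E.
  have := @integral_normal_pdf R 0 1; rewrite pdfE ge0_symfun_integralT.
  - rewrite (_ : [set x | _] = `[0%R, +oo[%classic); last first.
      by apply/seteqP; split => x/=; rewrite in_itv/= andbT.
    move=> h; rewrite -[LHS]mul1e (_ : 1 = (2^-1)%:E * 2%:E)%E; last first.
      by rewrite -EFinM mulVf.
    by rewrite -muleA h mule1.
  - by move=> x; rewrite mulr_ge0 ?expR_ge0// ltW.
  - by move=> x; apply: cvgM; [exact: cvg_cst|exact: cg].
  - by move=> x; rewrite /g /= sqrrN.
have ig : mu.-integrable `[0%R, +oo[ (EFin \o (fun x => c * g x)).
  rewrite -pdfE; apply: integrableS (integrable_normal_pdf 0 1) => //.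
have gE : g = (fun x => c^-1 * (c * g x)).
  by apply/funext => x; rewrite mulKf// gt_eqF.
split.
  rewrite gE; have := integrableZl _ c^-1 ig.
  by apply.
rewrite gE RintegralZl// /Rintegral I/= /c /normal_peak invrK expr1n mul1r.
rewrite [X in _ * X](_ : _ = Num.sqrt (2^-1 ^+ 2)); last first.
  by rewrite sqrtr_sqr ger0_norm.
rewrite -sqrtrM; last by rewrite mulrn_wge0// pi_ge0.
by congr Num.sqrt; field.
Qed.

Lemma half_gauss_moment1 :
  mu.-integrable `[0%R, +oo[ (EFin \o (fun x => x * g x)) /\
  \int[mu]_(x in `[0, +oo[) (x * g x) = 1.
Proof.
rewrite [X in _ /\ _ = X](_ : 1 = 0 - - g 0); last first.
  by rewrite /g expr0n/= mul0r oppr0 expR0; ring.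
apply: (@ge0_FTC2y R (fun x => x * g x) (fun x => - g x)).
- by move=> x x0; rewrite mulr_ge0// expR_ge0.
- by move=> x; apply: cvgM; [exact: cvg_id|exact: cg].
- by move=> x; rewrite /g; apply: is_derive_eq; rewrite /GRing.scale/=; field.
- rewrite -oppr0; apply: cvgN.
  apply: (@squeeze_cvgr _ _ _ _ (cst 0) (fun x => expR (1 / 2) * expR (- (2^-1 * x)))).
  + apply: nearW => x; rewrite expR_ge0/=.
    apply: le_trans (g_le x) _; rewrite -expRD ler_expR; lra.
  + exact: cvg_cst.
  + rewrite -[X in _ --> X](mulr0 (expR (1 / 2))); apply: cvgM; first exact: cvg_cst.
    exact: expRN_scale_cvg0.
Qed.

Lemma half_gauss_moment3 :
  mu.-integrable `[0%R, +oo[ (EFin \o (fun x => x ^+ 3 * g x)) /\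
  \int[mu]_(x in `[0, +oo[) (x ^+ 3 * g x) = 2.
Proof.
rewrite [X in _ /\ _ = X](_ : 2 = 0 - - ((0 ^+ 2 + 2) * g 0)); last first.
  by rewrite /g !expr0n/= mul0r oppr0 expR0; ring.
apply: (@ge0_FTC2y R (fun x => x ^+ 3 * g x) (fun x => - ((x ^+ 2 + 2) * g x))).
- by move=> x x0; rewrite mulr_ge0 ?exprn_ge0// expR_ge0.
- by move=> x; apply: cvgM; [exact: exprn_continuous|exact: cg].
- by move=> x; rewrite /g; apply: is_derive_eq; rewrite /GRing.scale/=; field.
- rewrite -oppr0; apply: cvgN.
  (* The antiderivative vanishes at infinity by squeezing: [poly_expR_bound] handles [x ^+ 2 * g x],
     and [g_le] handles [2 * g x]. *)
  have [K K0 hK] := poly_expR_bound R.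
  apply: (@squeeze_cvgr _ _ _ _ (cst 0) (fun x => K * expR (- (4^-1 * x)) +
    2 * expR (1 / 2) * expR (- (2^-1 * x)))).
  + near=> x; have x0 : 0 <= x by near: x; exact: nbhs_pinfty_ge.
    rewrite mulr_ge0 ?expR_ge0 ?addr_ge0 ?exprn_ge0//= mulrDl lerD//.
      rewrite (mulrC 4^-1); apply: le_trans (hK _ x0).
      rewrite ler_pM ?exprn_ge0 ?expR_ge0// -addrA lerDl.
      by rewrite addr_ge0// exprn_ge0.
    rewrite -mulrA ler_wpM2l//; apply: le_trans (g_le x) _.
    by rewrite -expRD ler_expR; lra.
  + exact: cvg_cst.
  + rewrite [X in _ --> X](_ : _ = K * 0 + 2 * expR (1 / 2) * 0); last first.
      by rewrite !mulr0 addr0.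
    by apply: cvgD; apply: cvgM; try exact: cvg_cst; exact: expRN_scale_cvg0.
Unshelve. all: end_near. Qed.

End gauss_moments.

(** * Ramanujan's Q-function: integral form and asymptotics *)

Definition ramanujan_Q (R : realType) (n : nat) : R :=
  \sum_(k < n) \prod_(1 <= j < k.+1) (1 - j%:R / n%:R).

Section ramanujan_Q_integral.
Context {R : realType}.
Notation mu := (@lebesgue_measure R).

(** Separating the scale [c] from [m] allows the recursion [qS] in [m] at fixed [c]. Taking
    [c = 1 / n] and [m = n - 1] recovers the Q-function, as [(n - 1 - j) / n = 1 - (j + 1) / n]. *)
Let q (c : R) (m : nat) : R := \sum_(k < m.+1) \prod_(j < k) ((m - j)%:R * c).

Let qS c m : q c m.+1 = 1 + m.+1%:R * c * q c m.
Proof.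
rewrite /q big_ord_recl big_ord0; congr +%R; rewrite mulr_sumr.
by apply: eq_bigr => k _; rewrite big_ord_recl subn0.
Qed.

Let ramanujan_QE n : (0 < n)%N -> ramanujan_Q R n = q n%:R^-1 n.-1.
Proof.
case: n => // n _; apply: eq_bigr => k _; rewrite big_add1/= big_mkord.
apply: eq_bigr => j _; rewrite -subSS natrB ?mulrBl ?divff//.
by rewrite ltnS (leq_trans (ltnW (ltn_ord j)))// -ltnS.
Qed.

(* An antiderivative of [y |-> exp (- s y) (1 + y / s) ^ m]: integrating by
   parts lowers [m] by one. *)
Let F (s : R) : nat -> R -> R := fix F m := match m with
  | 0 => fun y => - s^-1 * expR (- (s * y))
  | m'.+1 => fun y => - s^-1 * (expR (- (s * y)) * (1 + y / s) ^+ m) +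
                      m%:R / s ^+ 2 * F m' y
  end.

(** At 0 the boundary term of each integration by parts is [- s^-1], so the recursion of [F] becomes
    [qS] with [c = s ^- 2]. *)
Let F0 (s : R) m : 0 < s -> F s m 0 = - s^-1 * q (s ^- 2) m.
Proof.
move=> s0; elim: m => [|m IHm] /=.
  by rewrite mulr0 oppr0 expR0 /q big_ord1 big_ord0.
by rewrite IHm qS mulr0 mul0r oppr0 expR0 addr0 expr1n; ring.
Qed.

Let dF (s : R) m (y : R) : 0 < s ->
  is_derive y 1 (F s m) (expR (- (s * y)) * (1 + y / s) ^+ m).
Proof.
move=> s0; have sN0 : s != 0 by rewrite gt_eqF.
elim: m => [|m IHm] /=.
  by apply: is_derive_eq; rewrite /GRing.scale/=; field.
have d1 : is_derive y 1 (fun y => expR (- (s * y))) (- s * expR (- (s * y))).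
  by apply: is_derive_eq; rewrite /GRing.scale/=; ring.
have d2 : is_derive y 1 (fun y => 1 + y / s) s^-1.
  by apply: is_derive_eq; rewrite /GRing.scale/=; field.
have d3 : is_derive y 1 (fun y => (1 + y / s) ^+ m.+1)
    (m.+1%:R * (1 + y / s) ^+ m / s).
  by rewrite -exprfctE; apply: is_derive_eq (is_deriveX m.+1 d2) _.
have := is_deriveD (is_deriveZ (- s^-1) (is_deriveM d1 d3))
  (is_deriveZ (m.+1%:R / s ^+ 2) IHm).
move/is_derive_eq; apply; rewrite /GRing.scale/= exprS; field.
exact: sN0.
Qed.

Lemma ramanujan_Q_integral n (s : R) : (0 < n)%N -> 0 < s -> s ^+ 2 = n%:R ->
  let f y := expR (- (s * y)) * (1 + y / s) ^+ n.-1 in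
  mu.-integrable `[0%R, +oo[ (EFin \o f) /\
  \int[mu]_(y in `[0, +oo[) f y = ramanujan_Q R n / s.
Proof.
move=> n0 s0 sn f.
have [] := @ge0_FTC2y R f (F s n.-1) 0 0.
- move=> y y0; rewrite mulr_ge0 ?expR_ge0// exprn_ge0// addr_ge0//.
  by rewrite divr_ge0// ltW.
- move=> y; apply: cvgM.
    apply: continuous_comp; last exact: continuous_expR.
    by apply: cvgN; apply: cvgM; [exact: cvg_cst|exact: cvg_id].
  apply: (@cvg_comp _ _ _ (fun y => 1 + y / s) (fun x => x ^+ n.-1)).
    apply: cvgD; [exact: cvg_cst|apply: cvgM; [exact: cvg_id|exact: cvg_cst]].
  exact: exprn_continuous.
- by move=> y; exact: dF.
(* Boundary terms at infinity: as [1 + y / s >= 1], the power [m] is at most the power [n], which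
   [tilted_power_le] dominates. *)
- have e0 m : (m <= n)%N ->
      expR (- (s * y)) * (1 + y / s) ^+ m @[y --> +oo] --> (0 : R).
    move=> mn; apply: (@squeeze_cvgr _ _ _ _ (cst 0)
      (fun y => expR (1 / 2) * expR (- (2^-1 * y)))).
    + near=> y; have y0 : 0 <= y by near: y; exact: nbhs_pinfty_ge.
      have ys : 0 <= y / s by rewrite divr_ge0// ltW.
      rewrite mulr_ge0 ?expR_ge0 ?exprn_ge0 ?addr_ge0//=.
      apply: (@le_trans _ _ (expR ((1 - y) / 2))).
        apply: le_trans (tilted_power_le n0 s0 sn y0).
        by rewrite ler_wpM2l ?expR_ge0// ler_weXn2l// lerDl.
      by rewrite -expRD ler_expR; lra.
    + exact: cvg_cst.
    + rewrite -[X in _ --> X](mulr0 (expR (1 / 2))).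
      by apply: cvgM; [exact: cvg_cst|exact: expRN_scale_cvg0].
  have : (n.-1 <= n)%N by exact: leq_pred.
  elim: n.-1 => [_|m IHm mn] /=.
    rewrite -[X in _ --> X](mulr0 (- s^-1)).
    by apply: cvgM; [exact: cvg_cst|exact: expRN_scale_cvg0].
  rewrite [X in _ --> X](_ : _ = - s^-1 * 0 + m.+1%:R / s ^+ 2 * 0); last first.
    by rewrite !mulr0 addr0.
  by apply: cvgD; (apply: cvgM; first exact: cvg_cst); [exact: e0|exact/IHm/ltnW].
move=> i ->; split=> //.
by rewrite F0// ramanujan_QE// sn; ring.
Unshelve. all: end_near. Qed.

End ramanujan_Q_integral.

(** Integrating [gauss_estimate]: the moments 2 and 1 contribute [2 / (3 s) - 1 / s = - 1 / (3 s)],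
    and [poly_expR_bound] makes the error integral a constant over [s ^+ 2 = n]. *)
Lemma ramanujan_Q_asymptotic (R : realType) : exists C : R, forall n, (0 < n)%N ->
  `|ramanujan_Q R n / Num.sqrt n%:R -
    (Num.sqrt (pi / 2) - 1 / (3 * Num.sqrt n%:R))| <= C / n%:R.
Proof.
have [K K0 hK] := poly_expR_bound R.
pose mu := @lebesgue_measure R.
exists (K * \int[mu]_(y in `[0, +oo[) expR (- (4^-1 * y))) => n n0.
set s : R := Num.sqrt n%:R.
have s0 : 0 < s by rewrite sqrtr_gt0 ltr0n.
have sn : s ^+ 2 = n%:R by rewrite sqr_sqrtr.
pose f (y : R) := expR (- (s * y)) * (1 + y / s) ^+ n.-1.
pose g (y : R) := expR (- (y ^+ 2 / 2)).
have [iF IF] : mu.-integrable `[0%R, +oo[ (EFin \o f) /\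
    \int[mu]_(y in `[0, +oo[) f y = ramanujan_Q R n / s.
  exact: ramanujan_Q_integral.
have [i0 I0] : mu.-integrable `[0%R, +oo[ (EFin \o g) /\
    \int[mu]_(y in `[0, +oo[) g y = Num.sqrt (pi / 2).
  exact: half_gauss_integral.
have [i1 I1] : mu.-integrable `[0%R, +oo[ (EFin \o (fun y => y * g y)) /\
    \int[mu]_(y in `[0, +oo[) (y * g y) = 1.
  exact: half_gauss_moment1.
have [i3 I3] : mu.-integrable `[0%R, +oo[ (EFin \o (fun y => y ^+ 3 * g y)) /\
    \int[mu]_(y in `[0, +oo[) (y ^+ 3 * g y) = 2.
  exact: half_gauss_moment3.
have ie : mu.-integrable `[0%R, +oo[ (EFin \o (fun y => expR (- (4^-1 * y)))).
  exact: integrable_expRN_scale.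
have mI : measurable (`[0%R, +oo[%classic : set (measurableTypeR R)).
  exact: measurable_itv.
pose h (y : R) := f y - (g y + (3 * s)^-1 * (y ^+ 3 * g y) - s^-1 * (y * g y)).
have i3' := integrableZl mI (3 * s)^-1 i3.
have i1' := integrableZl mI s^-1 i1.
have i03 := integrableD mI i0 i3'.
have i031 := integrableB mI i03 i1'.
have ih : mu.-integrable `[0%R, +oo[ (EFin \o h).
  exact: (integrableB mI iF i031).
have Ih : \int[mu]_(y in `[0, +oo[) h y =
    ramanujan_Q R n / s - (Num.sqrt (pi / 2) - 1 / (3 * s)).
  rewrite RintegralB//= RintegralB//= RintegralD//= !RintegralZl//= IF I0 I1 I3.
  by field; rewrite gt_eqF.
rewrite -Ih; apply: le_trans (le_normr_Rintegral mI ih) _.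
rewrite mulrAC -RintegralZl//; apply: le_Rintegral => //.
- exact: integrable_norm.
- exact: (integrableZl mI (K / n%:R) ie).
move=> y; rewrite /= in_itv/= andbT => y0.
rewrite mulrAC -sn (_ : h y = f y - (g y + (y ^+ 3 / 3 - y) * g y / s)); last first.
  by rewrite /h; field; rewrite gt_eqF.
apply: le_trans (gauss_estimate n0 s0 sn y0) _.
rewrite ler_wpM2r ?invr_ge0 ?exprn_ge0 ?(ltW s0)//.
by rewrite (mulrC 4^-1); exact: hK.
Qed.

(** * Tail probabilities and the expected gain *)

Section uniform.
Context {R : realType} (mu : probability nat R) (n : nat).
Hypotheses (n0 : (0 < n)%N)
  (mu_unif : forall m, (1 <= m <= n)%N -> mu [set m] = (n%:R^-1)%:E).

Let mass_itv a b : (a <= b <= n)%N ->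
  mu [set m | (a < m <= b)%N] = ((b - a)%:R / n%:R)%:E.
Proof.
elim: b => [|b IHb] /andP[].
  rewrite leqn0 => /eqP -> _; rewrite (_ : [set _ | _] = set0) ?measure0 ?mul0r//.
  by apply/seteqP; split => m //=; case: m.
rewrite leq_eqVlt => /predU1P[-> _|].
  rewrite subnn mul0r (_ : [set _ | _] = set0) ?measure0//.
  by apply/seteqP; split => m //=; lia.
rewrite ltnS => ab bn.
rewrite (_ : [set _ | _] = [set m | (a < m <= b)%N] `|` [set b.+1]); last first.
  apply/seteqP; split => m /=; last by move=> [|->]; lia.
  by have [->|] := eqVneq m b.+1; [right|left; lia].
rewrite measureU//.
  transitivity (((b - a)%:R / n%:R)%:E + (n%:R^-1)%:E : \bar R)%E; last first.
    by rewrite -EFinD subSn// -natr1 mulrDl mul1r.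
  by apply: (f_equal2 adde); [apply: IHb; rewrite ab ltnW|exact: mu_unif].
by apply/seteqP; split => m //= [h mE]; lia.
Qed.

(* The mass of values above [n] never needs to be computed: the lower bound
   from [k < m <= n] and the upper bound from the complement of [1 <= m <= k]
   agree. *)
Lemma uniform_gt k : (k <= n)%N ->
  mu [set m | (k < m)%N] = (1 - k%:R / n%:R)%:E.
Proof.
move=> kn; have nN0 : n%:R != 0 :> R by rewrite pnatr_eq0 -lt0n.
have kE : (n - k)%:R / n%:R = 1 - k%:R / n%:R :> R.
  by rewrite natrB// mulrBl divff.
apply/eqP; rewrite eq_le; apply/andP; split; last first.
  rewrite -kE -mass_itv ?kn ?leqnn//; apply: le_measure; try exact/mem_set.
  by move=> m /= /andP[].
have : (mu [set m | (0 < m <= k)%N] + mu [set m | (k < m)%N] <= 1)%E.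
  rewrite -measureU//; first exact: probability_le1.
  by apply/seteqP; split => m //= []; lia.
by rewrite mass_itv ?kn// subn0 EFinB leeBrDr ?fin_num_measure// addeC.
Qed.

End uniform.

(** A minimum exceeds [k] exactly when every candidate does; the conjunct [k < n] accounts for the
    default value [n]. Tail events thus become intersections of conditions on single variables. *)
Lemma ltn_gain n (x : nat -> nat) k :
  (k < gain n x)%N <-> (k < n)%N /\ forall j, (1 <= j <= k)%N -> (j < x j)%N.
Proof.
have -> : (k < gain n x)%N = (k < n)%N &&
    all (fun i => (x i <= i)%N ==> (k < i)%N) (index_iota 1 n.+1).
  rewrite /gain; elim: (index_iota 1 n.+1) => [|i r IH]; first by rewrite big_nil andbT.
  rewrite big_cons/=; case: ifP => //= _.
  by rewrite leq_min IH andbCA.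
split=> [/andP[kn /allP h]|[kn h]].
  split=> // j jk; rewrite ltnNge; apply/negP => xj.
  have /h : j \in index_iota 1 n.+1 by rewrite mem_index_iota; lia.
  by rewrite xj/=; lia.
rewrite kn/=; apply/allP => j; rewrite mem_index_iota => jn; apply/implyP => xj.
by rewrite ltnNge; apply/negP => jk; have := h j; lia.
Qed.

(** The layer-cake form, from which the expectation becomes a sum of tail probabilities. *)
Lemma gain_sum n (x : nat -> nat) : gain n x = (\sum_(k < n) (k < gain n x))%N.
Proof.
have gn : (gain n x <= n)%N.
  by rewrite leqNgt; apply/negP => /ltn_gain[]; rewrite ltnn.
rewrite -[LHS]muln1 -[X in (X * _)%N]subn0 -sum_nat_const_nat big_mkord.
rewrite (big_ord_widen _ (fun=> 1%N) gn) big_mkcond.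
by apply: eq_bigr => k _; case: ifP.
Qed.

Section expected_gain.
Context {d : measure_display} {T : measurableType d} {R : realType}.
Context {P : probability T R} (n : nat) (X : nat -> {RV P >-> nat}).
Hypotheses (n0 : (0 < n)%N)
  (X_unif : forall k, (1 <= k)%N -> uniform_on_1_to n (X k))
  (X_indep : mutually_independent [set k : nat | (1 <= k)%N] X).

Let tail k := [set w | (k < gain n (fun j => X j w))%N].

(** This is the shape required by [mutually_independent]; [iota 1 k] lists the indices from 1 to
    [k]. *)
Let tailE k : (k < n)%N ->
  tail k = \bigcap_(j in [set` [fset i | i in iota 1 k]%fset])
    (X j @^-1` [set m | (j < m)%N]).
Proof.
move=> kn; apply/seteqP; split => w /=.
  move=> /ltn_gain[_ h] j /=; rewrite !inE/= mem_iota => jk; apply: h; lia.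
move=> h; apply/ltn_gain; split=> // j jk; apply: h.
by rewrite /= !inE/= mem_iota; lia.
Qed.

Let measurable_tail k : measurable (tail k).
Proof.
have [kn|nk] := ltnP k n.
  by rewrite tailE//; apply: fin_bigcap_measurable => // j _; exact: measurable_sfunP.
rewrite (_ : tail k = set0)//; apply/seteqP; split => // w /=.
by move=> /ltn_gain[]; lia.
Qed.

Let P_tail k : (k < n)%N ->
  P (tail k) = (\prod_(1 <= j < k.+1) (1 - j%:R / n%:R))%:E.
Proof.
move=> kn; rewrite tailE// X_indep//; last first.
  by move=> j /=; rewrite !inE/= mem_iota; lia.
rewrite (perm_big (iota 1 k)); last first.
  apply: uniq_perm; rewrite ?iota_uniq ?fset_uniq// => j.
  by rewrite !inE.
rewrite -prodEFin /index_iota subSS subn0 !big_seq; apply: eq_bigr => j.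
rewrite mem_iota => jk.
by apply: (@uniform_gt R (distribution P (X j))) => //; [apply: X_unif|]; lia.
Qed.

Lemma expected_gainE : expected_gain n X = ramanujan_Q R n.
Proof.
rewrite /expected_gain unlock.
have gE w : (gain n (fun k => X k w))%:R%:E =
    (\sum_(k < n) (\1_(tail k) w)%:E :> \bar R)%E.
  rewrite sumEFin {1}gain_sum natr_sum; congr EFin; apply: eq_bigr => k _.
  rewrite indicE; congr (nat_of_bool _)%:R.
  by apply/idP/idP => [h|/set_mem//]; exact/mem_set.
under eq_integral do rewrite gE.
rewrite ge0_integral_sum//; last first.
  by move=> k; exact/measurable_EFinP/measurable_indic.
rewrite (eq_bigr (fun k : 'I_n =>
    (\prod_(1 <= j < k.+1) (1 - j%:R / n%:R))%:E)) ?sumEFin// => k _.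
by rewrite integral_indic// setIT; exact: P_tail.
Qed.

End expected_gain.

(** * Passage to the limit *)

Lemma cvg_invsqrt (R : realType) : (Num.sqrt (n%:R : R))^-1 @[n --> \oo] --> (0 : R).
Proof.
apply/cvgrPdist_le => e e0; near=> n.
have n0 : (0 < n)%N by near: n; exact: nbhs_infty_gt.
rewrite sub0r normrN ger0_norm ?invr_ge0// invf_ple ?posrE ?sqrtr_gt0 ?ltr0n//.
rewrite -(ler_pXn2r (n := 2)) ?nnegrE ?invr_ge0 ?(ltW e0)// sqr_sqrtr//.
by near: n; exact: nbhs_infty_ger.
Unshelve. all: end_near. Qed.

Theorem proposition4p2 (R : realType) (d : nat -> measure_display)
    (T : forall n : nat, measurableType (d n))
    (P : forall n : nat, probability (T n) R)
    (X : forall n : nat, nat -> {RV (P n) >-> nat})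
    (X_uniform : forall n k : nat, (1 <= n)%N -> (1 <= k)%N ->
       uniform_on_1_to n (X n k))
    (X_indep : forall n : nat, (1 <= n)%N ->
       mutually_independent [set k : nat | (1 <= k)%N] (X n)) :
  let h : nat -> R^o := fun n => expected_gain n (X n) / Num.sqrt n%:R in
  (fun n : nat =>
     h n - (Num.sqrt (pi / 2) - 1 / (3 * Num.sqrt n%:R)) : R^o)
    =o_\oo (fun n : nat => 1 / Num.sqrt n%:R : R^o)
  /\ h n @[n --> \oo] --> Num.sqrt (pi / 2).
Proof.
move=> h.
have [C hC] := ramanujan_Q_asymptotic R.
pose r n := h n - (Num.sqrt (pi / 2) - 1 / (3 * Num.sqrt n%:R)).
(* The bound [C / n] is split in two factors: [C / sqrt n] tends to 0, and [1 / sqrt n] is the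
   comparison scale. *)
have r_le n : (0 < n)%N -> `|r n| <= C * (Num.sqrt n%:R)^-1 * (Num.sqrt n%:R)^-1.
  move=> n0; rewrite -mulrA -invfM -expr2 sqr_sqrtr// /r /h.
  rewrite expected_gainE//; first exact: hC.
    by move=> k k0; exact: X_uniform.
  exact: X_indep.
have Cs0 : C * (Num.sqrt (n%:R : R))^-1 @[n --> \oo] --> (0 : R).
  by rewrite -(mulr0 C); apply: cvgM; [exact: cvg_cst|exact: cvg_invsqrt].
have r_o : (r : nat -> R^o) =o_\oo (fun n : nat => 1 / Num.sqrt n%:R : R^o).
  apply/eqoP => e e0; near=> n.
  have n0 : (0 < n)%N by near: n; exact: nbhs_infty_gt.
  apply: le_trans (r_le _ n0) _.
  rewrite div1r [leRHS](_ : _ = e * (Num.sqrt n%:R)^-1); last first.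
    by congr *%R; rewrite ger0_norm ?invr_ge0.
  rewrite ler_wpM2r ?invr_ge0//.
  apply: le_trans (ler_norm _) _; near: n.
  by have /cvgr0Pnorm_le := Cs0; exact.
split; first exact: r_o.
have r0 : r n @[n --> \oo] --> (0 : R).
  apply/norm_cvg0P; apply: (@squeeze_cvgr _ _ _ _ (cst 0)
    (fun n => C * (Num.sqrt (n%:R : R))^-1 * (Num.sqrt n%:R)^-1)).
  - near=> n; rewrite normr_ge0/=; apply: r_le.
    by near: n; exact: nbhs_infty_gt.
  - exact: cvg_cst.
  - by rewrite -(mulr0 0); apply: cvgM; [exact: Cs0|exact: cvg_invsqrt].
have -> : h = (fun n => r n + (Num.sqrt (pi / 2) - 3^-1 * (Num.sqrt n%:R)^-1)).
  by apply/funext => n; rewrite /r div1r invfM subrK.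
rewrite -[X in _ --> X]add0r -[X in _ --> _ + X]subr0 -[X in _ --> _ + (_ - X)](mulr0 3^-1).
apply: cvgD; first exact: r0.
apply: cvgB; first exact: cvg_cst.
by apply: cvgM; [exact: cvg_cst|exact: cvg_invsqrt].
Unshelve. all: end_near. Qed.
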